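(* Let $R$ be a commutative ring with unity and let $n\ge 2$ be an integer. Let \[S_1=\{\,x_0^8+2x_1^4+4x_2^2 \pmod{8R} \;:\; x_0,x_1,x_2\in R\,\}\subseteq R/8R.\] Then a matrix $M\in M_n(R)$ is a sum of eighth powers of matrices in $M_n(R)$ (i.e., $M=\sum_{i=1}^r M_i^8$ for some $r\ge 1$ and $M_i\in M_n(R)$) if and only if $\operatorname{Tr} M\pmod{8R}\in S_1$.
   Context: $\operatorname{Tr}$ denotes the trace; $x\pmod{8R}$ denotes the image of $x\in R$ in $R/8R$. *)

(* Defs.v *)
From HB Require Import structures.
From mathcomp Require Import all_boot all_algebra.
From mathcomp Require Import boolp classical_sets.

Set Implicit Arguments.
Unset Strict Implicit.
Unset Printing Implicit Defensive.

Import GRing.Theory.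
Local Open Scope ring_scope.

Definition ideal8 (R : comPzRingType) : {pred R} :=
  fun x => `[< exists y : R, x = 8%:R * y >].

Fact ideal8_zmod_closed (R : comPzRingType) : zmod_closed (@ideal8 R).
Proof.
split; first by apply/asboolP; exists 0; rewrite mulr0.
move=> _ _ /asboolP [x ->] /asboolP [y ->].
by apply/asboolP; exists (x - y); rewrite mulrBr.
Qed.

HB.instance Definition _ (R : comPzRingType) :=
  GRing.isZmodClosed.Build R (@ideal8 R) (ideal8_zmod_closed R).

(* The additive group of R/8R.  MathComp only puts a ring structure on the
   quotient by a proper ideal, while 8R may be all of R (8 may be a unit);
   S_1 is the image of a subset of R, so the projection is all it needs. *)
Definition quot8 (R : comPzRingType) : Type := {ideal_quot (@ideal8 R)}.

Definition mod8 (R : comPzRingType) (x : R) : quot8 R :=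
  (\pi_({ideal_quot (@ideal8 R)}) x)%qT.

Definition S1 (R : comPzRingType) : set (quot8 R) :=
  [set q | exists x0 x1 x2 : R,
     q = mod8 (x0 ^+ 8 + 2%:R * x1 ^+ 4 + 4%:R * x2 ^+ 2)]%classic.
Arguments S1 R : clear implicits.

Definition sum_of_eighth_powers (R : comPzRingType) (n : nat) (M : 'M[R]_n) :
    Prop :=
  exists (r : nat) (N : 'I_r -> 'M[R]_n),
    (1 <= r)%N /\ M = \sum_(i < r) N i ^+ 8.

(* Main.v *)
(* For the necessity of the trace condition, expand M into elementary matrices
   and group the words of the expansion of Tr (M ^ 8) into orbits under
   rotation: an orbit of size d contributes d * x ^ (8 / d), and the values of
   x0 ^ 8 + 2 x1 ^ 4 + 4 x2 ^ 2 + 8 x3 are closed under addition.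

   Conversely, idempotents and 2 x 2 matrices of order 3 are eighth powers, and
   their sums give every matrix of trace 0, so only the trace matters.  The
   traces of sums of eighth powers of 2 x 2 matrices contain all
   t ^ 8 - 8 t ^ 6 s + 20 t ^ 4 s ^ 2 - 16 t ^ 2 s ^ 3 + 2 s ^ 4 (determinant s,
   trace t) and all 8! r, so they form a group, and polarizing these values
   gives 8 r, 4 r ^ 2, 2 r ^ 4 and r ^ 8. *)
Require Import Defs.
From HB Require Import structures.
From mathcomp Require Import all_boot all_algebra all_fingroup cyclic ring.
From mathcomp Require Import boolp classical_sets.

Set Implicit Arguments.
Unset Strict Implicit.
Unset Printing Implicit Defensive.

Import GRing.Theory.
Local Open Scope ring_scope.

(** * Orbit sums and traces of powers *)

Lemma closed_sum_porbits (R : nmodType) (T : finType) (s : {perm T})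
    (P : R -> Prop) (w : T -> R) :
  P 0 -> (forall x y, P x -> P y -> P (x + y)) ->
  (forall x, w (s x) = w x) -> (forall x, P (w x *+ #|porbit s x|)) ->
  P (\sum_x w x).
Proof.
move=> P0 PD ws Pw.
rewrite (partition_big (porbit s) [in porbits s]) /=; last first.
  by move=> x _; apply: imset_f.
apply: (big_ind P) => // _ /imsetP[y _ ->].
rewrite (eq_bigl [in porbit s y]) => [|x]; last by rewrite eq_porbit_mem.
rewrite (eq_bigr (fun=> w y)) ?sumr_const // => x /porbitP[i ->].
by elim: i => [|i IH]; rewrite ?perm1 // expgSr permM ws.
Qed.

Lemma prod_periodic (R : pzSemiRingType) (g : nat -> R) (d c : nat) :
  (forall k, g (k + d)%N = g k) ->
  \prod_(0 <= k < d * c) g k = (\prod_(0 <= k < d) g k) ^+ c.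
Proof.
move=> gd; elim: c => [|c IH]; first by rewrite muln0 big_geq.
rewrite mulnS exprS (big_cat_nat (n := d)) ?leq_addr //= -IH; congr (_ * _).
by rewrite addnC -{1}[d]add0n big_addn addnK; apply: eq_bigr => k _.
Qed.

Section TracePower.

Variables (R : comPzRingType) (n : nat).
Implicit Types (A W : 'M[R]_n).

Definition elementary W := exists a i j, W = a *: delta_mx i j.

Lemma elementary_mul V W : elementary V -> elementary W -> elementary (V * W).
Proof.
move=> [a [i [j ->]]] [b [k [l ->]]].
rewrite -mulmxE -scalemxAl -scalemxAr mul_delta_mx_cond scalerA.
exists (a * b *+ (j == k)), i, l.
by rewrite -scaler_nat scalerA mulr_natr.
Qed.

(** For [i != j] both sides vanish; for [i = j] the matrix is a scalar times an idempotent. *)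
Lemma elementary_sqr W : elementary W -> W * W = \tr W *: W.
Proof.
move=> [a [i [j ->]]].
rewrite -mulmxE -scalemxAl -scalemxAr mul_delta_mx_cond mxtraceZ.
have -> : \tr (delta_mx i j : 'M[R]_n) = (j == i)%:R.
  rewrite /mxtrace (bigD1 i) //= big1 ?addr0 => [|k ki].
    by rewrite mxE eqxx eq_sym.
  by rewrite mxE (negbTE ki).
rewrite !scalerA; case: (j == i).
  by rewrite mulr1n mulr1.
by rewrite mulr0n scaler0 mulr0 mul0r scale0r.
Qed.

Lemma elementary_trace_exp W c :
  elementary W -> (0 < c)%N -> \tr (W ^+ c) = \tr W ^+ c.
Proof.
move=> eW; case: c => // c _.
have -> : W ^+ c.+1 = \tr W ^+ c *: W.
  elim: c => [|c IH]; first by rewrite scale1r.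
  by rewrite exprS IH -mulmxE -scalemxAr mulmxE elementary_sqr // scalerA -exprSr.
by rewrite mxtraceZ -exprSr.
Qed.

(* Expanding [A] into elementary matrices, the words of length [m.+1] are
   grouped into orbits under rotation; a word whose orbit has size [d] is a
   power of its prefix of length [d]. *)
Lemma trace_exp_closed (P : R -> Prop) A m :
  P 0 -> (forall x y, P x -> P y -> P (x + y)) ->
  (forall d c x, (d * c)%N = m.+1 -> P (x ^+ c *+ d)) ->
  P (\tr (A ^+ m.+1)).
Proof.
move=> P0 PD Pdc.
pose B (p : 'I_n * 'I_n) : 'M[R]_n := A p.1 p.2 *: delta_mx p.1 p.2.
have eB p : elementary (B p) by exists (A p.1 p.2), p.1, p.2.
pose word (f : {ffun 'I_m.+1 -> 'I_n * 'I_n}) := \prod_i B (f i).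
have -> : A ^+ m.+1 = \sum_f word f.
  have {1}-> : A = \sum_p B p.
    by rewrite [LHS]matrix_sum_delta pair_bigA.
  by rewrite -[X in _ ^+ X]card_ord -prodr_const bigA_distr_bigA.
rewrite raddf_sum /=.
pose shift (f : {ffun 'I_m.+1 -> 'I_n * 'I_n}) := [ffun i => f (ordS i)].
have shift_inj : injective shift.
  move=> f g /ffunP fg; apply/ffunP => i.
  by have := fg (ord_pred i); rewrite !ffunE ord_predK.
(* [inZp] reduces indices modulo [m.+1], so [f] is read as a periodic sequence. *)
have iter_shift d f k : iter d shift f (inZp k) = f (inZp (k + d)).
  elim: d f k => [|d IH] f k; first by rewrite addn0.
  rewrite iterSr IH ffunE; congr (f _); apply: val_inj => /=.
  by rewrite addnS -addn1 modnDml addn1.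
(* A rotation moves the first factor of the word to the end, which leaves the trace unchanged. *)
apply: (@closed_sum_porbits _ _ (perm shift_inj)) => // f.
  rewrite permE /word big_ord_recr big_ord_recl /= -mulmxE mxtrace_mulC mulmxE.
  congr (\tr (_ * _)).
    by rewrite ffunE; congr (B (f _)); apply: val_inj; rewrite /= modnn.
  apply: eq_bigr => i _; rewrite ffunE; congr (B (f _)); apply: val_inj => /=.
  by rewrite modn_small // ltnS.
have iterE k g : iter k (perm shift_inj) g = iter k shift g.
  by apply: eq_iter => h; rewrite permE.
set d := #|_|.
have fd : iter d shift f = f by rewrite -iterE iter_porbit.
(* Rotating [m.+1] times is the identity, so every orbit size divides [m.+1]. *)
have d_dvd : (d %| m.+1)%N.
  rewrite /d porbitE (dvdn_trans (dvdn_orbit _ _ _)) // -orderE order_dvdn.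
  apply/eqP/permP => g; rewrite permX perm1 iterE; apply/ffunP => i.
  rewrite -[i]valZpK iter_shift; congr (g _).
  by apply: val_inj; rewrite /= modnDr.
have d_gt0 : (0 < d)%N by apply: dvdn_gt0 d_dvd.
have -> : word f = (\prod_(0 <= k < d) B (f (inZp k))) ^+ (m.+1 %/ d).
  rewrite -prod_periodic => [|k]; last by rewrite -iter_shift fd.
  rewrite mulnC divnK // big_mkord; apply: eq_bigr => i _.
  by rewrite valZpK.
have eW : elementary (\prod_(0 <= k < d) B (f (inZp k))).
  move: (d) d_gt0 => [//|e] _; elim: e => [|e IH]; first by rewrite big_nat1.
  by rewrite big_nat_recr //=; apply: elementary_mul.
have c_gt0 : (0 < m.+1 %/ d)%N by rewrite divn_gt0 // dvdn_leq.
rewrite (elementary_trace_exp eW c_gt0).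
by apply: Pdc; rewrite mulnC divnK.
Qed.

End TracePower.

(** * The trace condition and its necessity *)

(** The term in [x3] lifts the congruence modulo 8R to an equation in R. *)
Definition trace_form (R : comPzRingType) (z : R) :=
  exists x0 x1 x2 x3 : R,
    z = x0 ^+ 8 + 2%:R * x1 ^+ 4 + 4%:R * x2 ^+ 2 + 8%:R * x3.

Lemma mod8_S1P (R : comPzRingType) (z : R) :
  mod8 z \in S1 R <-> trace_form z.
Proof.
have mod8P (x y : R) : mod8 x = mod8 y <-> exists u, x = y + 8%:R * u.
  split=> [/eqP|[u ->]]; last apply/eqP; rewrite /mod8 -Quotient.idealrBE.
    by move=> /asboolP[u xy]; exists u; rewrite -xy addrC subrK.
  by apply/asboolP; exists u; rewrite addrC addKr.
rewrite in_setE; split=> [[x0 [x1 [x2 /mod8P[x3 ->]]]]|].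
  by exists x0, x1, x2, x3.
by move=> [x0 [x1 [x2 [x3 ->]]]]; exists x0, x1, x2; apply/mod8P; exists x3.
Qed.

Lemma trace_form0 (R : comPzRingType) : trace_form (0 : R).
Proof. by exists 0, 0, 0, 0; ring. Qed.

Lemma trace_formD (R : comPzRingType) (y z : R) :
  trace_form y -> trace_form z -> trace_form (y + z).
Proof.
move=> [x0 [x1 [x2 [x3 ->]]]] [y0 [y1 [y2 [y3 ->]]]].
(* Modulo 8, x0^8 + y0^8 = (x0 + y0)^8 + 2 u^4 + 4 v^2. Merging the fourth powers of x1, y1 and then
   u costs 4 p^2 and 4 q^2, and squares times 4 are additive. The last witness collects the
   multiples of 8. *)
pose u := x0 * y0; pose v := x0 ^+ 3 * y0 + x0 * y0 ^+ 3.
pose p := x1 * y1; pose q := (x1 + y1) * u.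
exists (x0 + y0), (x1 + y1 + u), (x2 + y2 + v + p + q).
exists (x3 + y3
  - (x0 ^+ 7 * y0 + x0 * y0 ^+ 7) - 4%:R * (x0 ^+ 4 + y0 ^+ 4) * u ^+ 2
  - 7%:R * (x0 ^+ 2 + y0 ^+ 2) * u ^+ 3 - 10%:R * u ^+ 4
  - (x1 ^+ 2 + y1 ^+ 2) * p - 2%:R * p ^+ 2
  - ((x1 + y1) ^+ 2 + u ^+ 2) * q - 2%:R * q ^+ 2
  - (x2 * y2 + (x2 + y2) * v + (x2 + y2 + v) * p + (x2 + y2 + v + p) * q)).
by rewrite /q /p /v /u; ring.
Qed.

Lemma trace_form_sum_of_eighth_powers (R : comPzRingType) n (M : 'M[R]_n) :
  sum_of_eighth_powers M -> trace_form (\tr M).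
Proof.
move=> [r [N [_ ->]]]; rewrite raddf_sum /=.
apply: big_ind => [||i _]; [exact: trace_form0 | exact: trace_formD |].
apply: trace_exp_closed => [||d c x dc];
  [exact: trace_form0 | exact: trace_formD |].
have : d \in [:: 1; 2; 4; 8]%N.
  by rewrite -[[:: 1; 2; 4; 8]%N]/(divisors 8) -dvdn_divisors // -dc dvdn_mulr.
have -> : c = (8 %/ d)%N by rewrite -dc mulKn //; case: (d) dc.
rewrite !inE => /or4P[] /eqP->.
- by exists x, 0, 0, 0; rewrite -[(8 %/ 1)%N]/8%N; ring.
- by exists 0, x, 0, 0; rewrite -[(8 %/ 2)%N]/4%N; ring.
- by exists 0, 0, x, 0; rewrite -[(8 %/ 4)%N]/2%N; ring.
- by exists 0, 0, 0, x; rewrite -[(8 %/ 8)%N]/1%N; ring.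
Qed.

(** * Closure properties of sums of eighth powers *)

Section SumOfEighthPowers.

Variables (R : comPzRingType) (n : nat).
Implicit Types (M N X : 'M[R]_n).

Lemma sum_of_eighth_powers_exp N : sum_of_eighth_powers (N ^+ 8).
Proof. by exists 1%N, (fun=> N); rewrite big_ord1. Qed.

Lemma sum_of_eighth_powers0 : sum_of_eighth_powers (0 : 'M[R]_n).
Proof. by have := sum_of_eighth_powers_exp 0; rewrite expr0n. Qed.

Lemma sum_of_eighth_powersD M N :
  sum_of_eighth_powers M -> sum_of_eighth_powers N ->
  sum_of_eighth_powers (M + N).
Proof.
move=> [r [F [r_gt0 ->]]] [s [G [_ ->]]].
exists (r + s)%N, (fun i => match split i with inl j => F j | inr k => G k end).
split; first by rewrite addn_gt0 r_gt0.
rewrite big_split_ord /=; congr (_ + _); apply: eq_bigr => i _.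
  by rewrite (unsplitK (inl i)).
by rewrite (unsplitK (inr i)).
Qed.

Lemma sum_of_eighth_powers_idem X : X * X = X -> sum_of_eighth_powers X.
Proof.
move=> XX; have <- : X ^+ 8 = X by rewrite !exprS expr0 mulr1 !XX.
exact: sum_of_eighth_powers_exp.
Qed.

(** Y^4 = X^2 = Y, hence Y^8 = Y^2 = X. *)
Lemma sum_of_eighth_powers_order3 X Y :
  X * X = Y -> Y * Y = X -> sum_of_eighth_powers X.
Proof.
move=> XX YY; have <- : Y ^+ 8 = X.
  by rewrite (exprM Y 4 2) (exprM Y 2 2) !expr2 YY XX YY.
exact: sum_of_eighth_powers_exp.
Qed.

Lemma sum_of_eighth_powers_conj m (Q : 'M[R]_(m, n)) (X : 'M[R]_m) :
  Q *m Q^T = 1%:M -> sum_of_eighth_powers X ->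
  sum_of_eighth_powers (Q^T *m X *m Q).
Proof.
move=> QQ [r [F [_ ->]]]; rewrite mulmx_sumr mulmx_suml.
apply: big_ind => [||i _];
  [exact: sum_of_eighth_powers0 | exact: sum_of_eighth_powersD |].
suff <- : (Q^T *m F i *m Q) ^+ 8 = Q^T *m F i ^+ 8 *m Q.
  exact: sum_of_eighth_powers_exp.
(* Induction on positive exponents: at exponent 0 the identity could fail, since [Q^T *m Q] may
   differ from 1. *)
elim: 7%N => [|k IH]; first by rewrite !expr1.
by rewrite exprS IH (exprS (F i) k.+1) -!mulmxE !mulmxA -(mulmxA _ Q) QQ mulmx1.
Qed.

End SumOfEighthPowers.

(** * Matrices of size 2 with trace zero *)

Section TwoByTwo.

Variable R : comPzRingType.
Implicit Types a b c d r s t : R.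

Definition mx2 a b c d : 'M[R]_2 :=
  \matrix_(i, j) if i == 0 then (if j == 0 then a else b)
                 else if j == 0 then c else d.

Lemma mx2M a b c d a' b' c' d' :
  mx2 a b c d * mx2 a' b' c' d' =
  mx2 (a * a' + b * c') (a * b' + b * d') (c * a' + d * c') (c * b' + d * d').
Proof.
apply/matrixP => i j; rewrite !mxE !big_ord_recl big_ord0 !mxE /= addr0.
by case: ifP; case: ifP.
Qed.

Lemma mx2D a b c d a' b' c' d' :
  mx2 a b c d + mx2 a' b' c' d' = mx2 (a + a') (b + b') (c + c') (d + d').
Proof. by apply/matrixP => i j; rewrite !mxE; case: ifP; case: ifP. Qed.

Lemma mxtrace_mx2 a b c d : \tr (mx2 a b c d) = a + d.
Proof. by rewrite /mxtrace !big_ord_recl big_ord0 !mxE addr0. Qed.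

Lemma sum_of_eighth_powers_mx2_trace0 a b c :
  sum_of_eighth_powers (mx2 a b c (- a)).
Proof.
have idem p q u v : p * p + q * u = p -> p * q + q * v = q ->
    u * p + v * u = u -> u * q + v * v = v ->
    sum_of_eighth_powers (mx2 p q u v).
  by move=> *; apply: sum_of_eighth_powers_idem; rewrite mx2M; congr mx2.
have N11 : sum_of_eighth_powers (mx2 (- 1) 0 0 0).
  (* The last two matrices have trace -1 and determinant 1, hence cube 1; their off-diagonal entries
     cancel. *)
  have -> : mx2 (- 1) 0 0 0 =
      mx2 1 0 0 0 + (mx2 (- 1) 1 (- 1) 0 + mx2 (- 1) (- 1) 1 0).
    by rewrite !mx2D; congr mx2; ring.
  apply: sum_of_eighth_powersD; first by apply: idem; ring.
  apply: sum_of_eighth_powersD.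
    apply: (@sum_of_eighth_powers_order3 _ _ _ (mx2 0 (- 1) 1 (- 1)));
    by rewrite mx2M; congr mx2; ring.
  apply: (@sum_of_eighth_powers_order3 _ _ _ (mx2 0 1 (- 1) (- 1)));
  by rewrite mx2M; congr mx2; ring.
have off12 q : sum_of_eighth_powers (mx2 0 q 0 0).
  have -> : mx2 0 q 0 0 = mx2 1 q 0 0 + mx2 (- 1) 0 0 0.
    by rewrite mx2D; congr mx2; ring.
  by apply: sum_of_eighth_powersD => //; apply: idem; ring.
have off21 q : sum_of_eighth_powers (mx2 0 0 q 0).
  have -> : mx2 0 0 q 0 = mx2 1 0 q 0 + mx2 (- 1) 0 0 0.
    by rewrite mx2D; congr mx2; ring.
  by apply: sum_of_eighth_powersD => //; apply: idem; ring.
(* Two equal rows with entries summing to 1 form an idempotent; this one has the right diagonal up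
   to 1 in the corner. *)
have -> : mx2 a b c (- a) = mx2 (1 + a) (- a) (1 + a) (- a) +
    (mx2 (- 1) 0 0 0 + (mx2 0 (a + b) 0 0 + mx2 0 0 (c - 1 - a) 0)).
  by rewrite !mx2D; congr mx2; ring.
apply: sum_of_eighth_powersD; first by apply: idem; ring.
by do 2!apply: sum_of_eighth_powersD => //.
Qed.

(** * The group of traces attained in size 2 *)

Definition eighth_trace t :=
  exists2 X : 'M[R]_2, sum_of_eighth_powers X & \tr X = t.

Lemma eighth_traceD s t :
  eighth_trace s -> eighth_trace t -> eighth_trace (s + t).
Proof.
move=> [X hX <-] [Y hY <-]; exists (X + Y); last by rewrite raddfD.
exact: sum_of_eighth_powersD.
Qed.

Lemma eighth_traceMn t k : eighth_trace t -> eighth_trace (t *+ k).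
Proof.
move=> ht; elim: k => [|k IH]; last by rewrite mulrS; apply: eighth_traceD.
by exists 0; [exact: sum_of_eighth_powers0 | rewrite raddf0].
Qed.

(** This is the sum of the eighth powers of the roots of X^2 - t X + s, read off from its companion
    matrix. *)
Lemma eighth_trace_power_sum t s : eighth_trace
  (t ^+ 8 - 8%:R * t ^+ 6 * s + 20%:R * t ^+ 4 * s ^+ 2
   - 16%:R * t ^+ 2 * s ^+ 3 + 2%:R * s ^+ 4).
Proof.
exists (mx2 t (- s) 1 0 ^+ 8); first exact: sum_of_eighth_powers_exp.
rewrite (exprM _ 4 2) (exprM _ 2 2) !expr2 !mx2M mxtrace_mx2; ring.
Qed.

Lemma eighth_traceN t : eighth_trace t -> eighth_trace (- t).
Proof.
have x8 r : eighth_trace (r ^+ 8).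
  by have := eighth_trace_power_sum r 0; congr eighth_trace; ring.
have Nx8 r : eighth_trace (- r ^+ 8).
  (* the eigenvalues are [r] times the two primitive cube roots of unity *)
  by have := eighth_trace_power_sum (- r) (r ^+ 2); congr eighth_trace; ring.
(* the seventh finite difference of [r ^ 8] is [8! * r] plus a constant *)
have fact8 r : eighth_trace (r *+ 8`!).
  have D k m : eighth_trace (((r + m%:R) ^+ 8 - m%:R ^+ 8) *+ k).
    exact/eighth_traceMn/eighth_traceD.
  have ND k m : eighth_trace ((m%:R ^+ 8 - (r + m%:R) ^+ 8) *+ k).
    exact/eighth_traceMn/eighth_traceD.
  have -> : r *+ 8`! =
      ((r + 7%:R) ^+ 8 - 7%:R ^+ 8) *+ 1 + (6%:R ^+ 8 - (r + 6%:R) ^+ 8) *+ 7 +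
      ((r + 5%:R) ^+ 8 - 5%:R ^+ 8) *+ 21 + (4%:R ^+ 8 - (r + 4%:R) ^+ 8) *+ 35 +
      ((r + 3%:R) ^+ 8 - 3%:R ^+ 8) *+ 35 + (2%:R ^+ 8 - (r + 2%:R) ^+ 8) *+ 21 +
      ((r + 1%:R) ^+ 8 - 1%:R ^+ 8) *+ 7 + (0%:R ^+ 8 - (r + 0%:R) ^+ 8) *+ 1.
    by rewrite -[r *+ _]mulr_natr !factS fact0 !natrM; ring.
  by do 7!apply: eighth_traceD => //.
move=> ht; have := fact8 (- t); have := fact_gt0 8.
case: (8`!) => // k _ hk.
(* Here [k.+1] is 8!, and the multiple of [- t] by 8! is already attained. *)
have -> : - t = t *+ k + (- t) *+ k.+1 by rewrite mulrS mulNrn; ring.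
by apply: eighth_traceD => //; apply: eighth_traceMn.
Qed.

Lemma eighth_traceB s t :
  eighth_trace s -> eighth_trace t -> eighth_trace (s - t).
Proof. by move=> hs ht; apply: eighth_traceD => //; apply: eighth_traceN. Qed.

Lemma trace_form_eighth_trace z : trace_form z -> eighth_trace z.
Proof.
have G1 r : eighth_trace (r ^+ 8).
  by have := eighth_trace_power_sum r 0; congr eighth_trace; ring.
have G2 r : eighth_trace (2%:R * r ^+ 4).
  by have := eighth_trace_power_sum 0 r; congr eighth_trace; ring.
(* Trace 1 and determinant [r], with the pure powers removed; the even part of the result gives 40
   r^2. *)
have Gu r : eighth_trace (20%:R * r ^+ 2 - 8%:R * r - 16%:R * r ^+ 3).
  have := eighth_traceB (eighth_trace_power_sum 1 r)
    (eighth_traceD (G2 r) (G1 1)).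
  by congr eighth_trace; ring.
have G40 r : eighth_trace (40%:R * r ^+ 2).
  by have := eighth_traceD (Gu r) (Gu (- r)); congr eighth_trace; ring.
(* Second difference of 2 r^4; then 2 * 24 - 40 = 8. *)
have G24 r : eighth_trace (24%:R * r ^+ 2).
  have := eighth_traceB (eighth_traceB (eighth_traceD (G2 (r + 1)) (G2 (r - 1)))
    (eighth_traceMn 2 (G2 r))) (eighth_traceMn 2 (G2 1)).
  by congr eighth_trace; ring.
have G8sqr r : eighth_trace (8%:R * r ^+ 2).
  have := eighth_traceB (eighth_traceMn 2 (G24 r)) (G40 r).
  by congr eighth_trace; ring.
have G16 r : eighth_trace (16%:R * r).
  have := eighth_traceB (eighth_traceB (G8sqr (r + 1)) (G8sqr r)) (G8sqr 1).
  by congr eighth_trace; ring.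
(* Multiples of 16 reduce [Gu] to this quadratic, whose first difference gives 8 r. *)
have Gv r : eighth_trace (4%:R * r ^+ 2 + 8%:R * r).
  have := eighth_traceD (Gu r) (G16 (r - r ^+ 2 + r ^+ 3)).
  by congr eighth_trace; ring.
have G8 r : eighth_trace (8%:R * r).
  have := eighth_traceB (eighth_traceB (Gv (r + 1)) (Gv r)) (Gv 1).
  by congr eighth_trace; ring.
have G4 r : eighth_trace (4%:R * r ^+ 2).
  by have := eighth_traceB (Gv r) (G8 r); congr eighth_trace; ring.
by move=> [x0 [x1 [x2 [x3 ->]]]]; do 3!apply: eighth_traceD => //.
Qed.

End TwoByTwo.

(** * Passage from size 2 to size n *)

Section Embedding.

Variables (R : comPzRingType) (n : nat) (i j : 'I_n).
Hypothesis ij : i != j.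

(** The rows are the unit vectors at [i] and [j], so [Q^T *m X *m Q] places [X] in rows and columns
    [i], [j]. *)
Let Q : 'M[R]_(2, n) := delta_mx 0 i + delta_mx 1 j.

Let QT : Q^T = delta_mx i 0 + delta_mx j 1.
Proof. by rewrite /Q raddfD /= !trmx_delta. Qed.

Let QQ : Q *m Q^T = 1%:M.
Proof.
rewrite QT mulmxDl !mulmxDr !mul_delta_mx_cond !eqxx.
rewrite (negbTE ij) eq_sym (negbTE ij) !mulr0n !mulr1n add0r addr0.
apply/matrixP => k l; rewrite !mxE.
by case: k l => [[|[]]] //= ? [[|[]]] //= ?; rewrite ?addr0 ?add0r.
Qed.

Lemma embed_mx2 a b c d :
  Q^T *m mx2 a b c d *m Q = a *: delta_mx i i + b *: delta_mx i j
                          + c *: delta_mx j i + d *: delta_mx j j.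
Proof.
have -> : mx2 a b c d = a *: delta_mx 0 0 + b *: delta_mx 0 1
                      + c *: delta_mx 1 0 + d *: delta_mx 1 1.
  apply/matrixP => k l; rewrite !mxE.
  by case: k l => [[|[]]] //= ? [[|[]]] //= ?;
    rewrite !(mulr0, mulr1, addr0, add0r).
have E k l : Q^T *m delta_mx k l *m Q =
    delta_mx (if k == 0 then i else j) (if l == 0 then i else j).
  have ord2 (h : 'I_2) : h = 0 \/ h = 1.
    by case: h => [[|[]]] // h; [left | right]; apply: val_inj.
  case: (ord2 k) (ord2 l) => -> [] ->; rewrite QT mulmxDl !mul_delta_mx_cond;
  by rewrite mulmxDl !mulmxDr !mul_delta_mx_cond ?mulr0n ?mulr1n ?mul0mx
    ?(addr0, add0r).
move: (Q^T) (Q) E => U V E.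
by rewrite !mulmxDr !mulmxDl -!scalemxAr -!scalemxAl !E.
Qed.

Lemma sum_of_eighth_powers_embed_trace0 a b c :
  sum_of_eighth_powers (a *: delta_mx i i + b *: delta_mx i j
                        + c *: delta_mx j i - a *: delta_mx j j : 'M[R]_n).
Proof.
rewrite -scaleNr -embed_mx2; apply: sum_of_eighth_powers_conj => //.
exact: sum_of_eighth_powers_mx2_trace0.
Qed.

Lemma eighth_trace_embed t : eighth_trace t ->
  exists2 M : 'M[R]_n, sum_of_eighth_powers M & \tr M = t.
Proof.
move=> [X hX <-]; exists (Q^T *m X *m Q).
  exact: sum_of_eighth_powers_conj.
by rewrite -mulmxA mxtrace_mulC -mulmxA QQ mulmx1.
Qed.

End Embedding.

(** Subtracting each diagonal entry at position [i0] changes nothing in total, and leaves summands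
    of trace zero, each zero or supported on a block of size 2. *)
Lemma sum_of_eighth_powers_trace0 (R : comPzRingType) n
    (i0 : 'I_n) (M : 'M[R]_n) :
  \tr M = 0 -> sum_of_eighth_powers M.
Proof.
move=> trM.
have -> : M = \sum_i \sum_j
    (M i j *: delta_mx i j - (M i j *+ (i == j)) *: delta_mx i0 i0).
  rewrite {1}[M]matrix_sum_delta.
  under [RHS]eq_bigr do rewrite sumrB -scaler_suml.
  rewrite sumrB -scaler_suml.
  have -> : \sum_i \sum_j M i j *+ (i == j) = \tr M.
    apply: eq_bigr => i _; rewrite (bigD1 i) //= eqxx big1 ?addr0 // => j ji.
    by rewrite eq_sym (negbTE ji).
  by rewrite trM scale0r subr0.
apply: big_ind => [||i _];
  [exact: sum_of_eighth_powers0 | exact: sum_of_eighth_powersD |].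
apply: big_ind => [||j _];
  [exact: sum_of_eighth_powers0 | exact: sum_of_eighth_powersD |].
case: eqVneq => [<-|ij].
  case: (eqVneq i i0) => [->|ii0].
    by rewrite subrr; apply: sum_of_eighth_powers0.
  have := @sum_of_eighth_powers_embed_trace0 R n i i0 ii0 (M i i) 0 0.
  by rewrite !scale0r !addr0.
have := @sum_of_eighth_powers_embed_trace0 R n i j ij 0 (M i j) 0.
by rewrite /= mulr0n !scale0r add0r addr0.
Qed.

Theorem theorem4p3 (R : comPzRingType) (n : nat) (hn : (2 <= n)%N) (M : 'M[R]_n) :
  sum_of_eighth_powers M <-> mod8 (\tr M) \in S1 R.
Proof.
rewrite mod8_S1P; split; first exact: trace_form_sum_of_eighth_powers.
case: n hn M => [|[|n]] // _ M /trace_form_eighth_trace htr.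
(* The indices [ord0] and [ord_max] differ because the size is at least 2; [M - N] then has trace
   zero. *)
have [N hN trN] := @eighth_trace_embed R n.+2 ord0 ord_max isT _ htr.
rewrite -[M](subrK N); apply: sum_of_eighth_powersD => //.
by apply: (sum_of_eighth_powers_trace0 ord0); rewrite raddfB /= trN subrr.
Qed.
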